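(* Let $F$ and $L$ be non-Archimedean valued fields with $L$ a finite extension of $F$ as a valued field such that: (i) $\mathbb{Q}\subseteq F$ and the valuation logarithm $\nu$ on $F$, when restricted to $\mathbb{Q}$, is a $p$-adic valuation logarithm (for some prime $p$); (ii) the residue field $\overline{F}$ is finite (and so $\overline{L}$ is also finite); (iii) the elements of $\mathrm{Gal}(L/F)$ are isometric on $L$. Then for each $g\in\mathrm{Gal}(L/F)$ there exists a set $\mathcal{R}_{L,g}\subseteq\mathcal{O}_{L}^{\times}\cup\{0\}$ of residue class representatives for $L$ such that $g$ restricts to an endofunction $g|_{\mathcal{R}_{L,g}}:\mathcal{R}_{L,g}\to\mathcal{R}_{L,g}$.
   Context: A valuation on a field $F$ is a multiplicative norm $|\cdot|_{F}:F\to\mathbb{R}$; it is non-Archimedean if $|a-b|_F\le\max(|a|_F,|b|_F)$ for all $a,b\in F$. $L$ extends $F$ as a valued field if $F$ is a subfield of $L$ and $|\cdot|_L$ restricts to $|\cdot|_F$. A valuation logarithm on $F$ is a map $\nu:F\to\mathbb{R}\cup\{\infty\}$ with $|a|_F=r^{-\nu(a)}$ for all $a\in F$ and some fixed $r>1$. The $p$-adic valuation logarithm $\nu_p$ on $\mathbb{Q}$ is the usual $p$-adic order, with $\nu_p(0)=\infty$. For a non-Archimedean field $K$: $\mathcal{O}_K=\{a:|a|_K\le1\}$, $\mathcal{O}_K^\times=\{a:|a|_K=1\}$, $\mathcal{M}_K=\{a:|a|_K<1\}$, $\overline{K}=\mathcal{O}_K/\mathcal{M}_K$ is the residue field. A set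 of residue class representatives for $L$ is a subset of $\mathcal{O}_L$ containing exactly one element of each residue class in $\overline{L}$ (with $0$ representing $\bar{0}$). $\mathrm{Gal}(L/F)$ is the group of automorphisms of $L$ fixing $F$ pointwise. *)

(* Defs.v *)
From mathcomp Require Import all_boot all_order all_algebra all_field.
From mathcomp Require Import all_classical all_reals all_analysis.

Set Implicit Arguments.
Unset Strict Implicit.
Unset Printing Implicit Defensive.

Import Order.TTheory GRing.Theory Num.Theory.
Local Open Scope classical_set_scope.
Local Open Scope ring_scope.

Definition is_valuation (R : realType) (K : fieldType) (v : K -> R) : Prop :=
  [/\ forall a, 0 <= v a,
      forall a, v a = 0 <-> a = 0,
      forall a b, v (a + b) <= v a + v b
    & forall a b, v (a * b) = v a * v b].

Definition is_nonarchimedean (R : realType) (K : fieldType) (v : K -> R) : Prop :=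
  is_valuation v /\ forall a b, v (a - b) <= Num.max (v a) (v b).

(* r ^ (- x) for x in R u {oo}, with r ^ (- oo) = 0; the value at -oo is
   irrelevant, since is_valuation_log excludes it. *)
Definition powRN (R : realType) (r : R) (x : \bar R) : R :=
  match x with
  | y%:E => r `^ (- y)
  | _ => 0
  end.

Definition is_valuation_log (R : realType) (K : fieldType)
    (v : K -> R) (nu : K -> \bar R) : Prop :=
  (forall a, nu a <> -oo%E) /\
  exists2 r : R, 1 < r & forall a, v a = powRN r (nu a).

Definition padic_log (R : realType) (p : nat) (q : rat) : \bar R :=
  if q == 0 then +oo%E
  else ((logn p `|numq q|)%:R - (logn p `|denq q|)%:R)%:E.

Definition integers (R : realType) (K : fieldType) (v : K -> R) : set K :=
  [set a | v a <= 1].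

Definition integer_units (R : realType) (K : fieldType) (v : K -> R) : set K :=
  [set a | v a = 1].

Definition max_ideal (R : realType) (K : fieldType) (v : K -> R) : set K :=
  [set a | v a < 1].

Definition residue_class (R : realType) (K : fieldType) (v : K -> R) (a : K) :
    set K :=
  [set a + m | m in max_ideal v].

(* The underlying set of the quotient ring: the cosets a + M_K, a in O_K. *)
Definition residue_field (R : realType) (K : fieldType) (v : K -> R) :
    set (set K) :=
  [set residue_class v a | a in integers v].

Definition residue_representatives (R : realType) (K : fieldType) (v : K -> R)
    (S : set K) : Prop :=
  [/\ S `<=` integers v,
      S 0
    & forall C, residue_field v C -> exists! x, (S `&` C) x].

(* The extension F <= L is given by the structure map a |-> a%:A. *)
Definition extends_valuation (R : realType) (F : fieldType) (L : fieldExtType F)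
    (vF : F -> R) (vL : L -> R) : Prop :=
  forall a : F, vL a%:A = vF a.

(* The library's 'Gal(E / K) needs an ambient splitting field, whereas L / F is
   not assumed to be normal. *)
Definition in_Gal (F : fieldType) (L : fieldExtType F) (g : {rmorphism L -> L}) :
    Prop :=
  bijective g /\ forall a : F, g a%:A = a%:A.

Definition is_isometry (R : realType) (K : fieldType) (v : K -> R) (g : K -> K) :
    Prop :=
  forall x y, v (g x - g y) = v (x - y).

(* Main.v *)
Require Import Defs.
From mathcomp Require Import all_boot all_order all_algebra all_field.
From mathcomp Require Import all_classical all_reals all_analysis.

Set Implicit Arguments.
Unset Strict Implicit.
Unset Printing Implicit Defensive.

Import Order.TTheory GRing.Theory Num.Theory.
Local Open Scope classical_set_scope.
Local Open Scope ring_scope.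

(** Write [a ≡ b] for congruence modulo the maximal ideal of the integers of L.
    A system of representatives stable under g can only contain elements x such
    that [iter j g x ≡ x] implies [iter j g x = x]; conversely, choosing one such
    element in one residue class of each g-orbit of classes and taking its
    g-orbit produces a stable system, because g is isometric.  So it is enough
    to show that every residue class stable under a power h of g contains a
    fixed point of h ([exists_fixed_point_congm]).

    The field L is not assumed to be complete, so Teichmueller representatives,
    which would be fixed points, need not exist.  They are replaced by a finite
    computation.  An element a of the class has finitely many conjugates over F,
    hence it has a finite period N = p ^ s * m under h, with m prime to p
    ([iter_periodic]).  The product b of the elements [iter (m * i) h a],
    i < p ^ s, is fixed by [iter m h] and congruent to a ^ (p ^ s); the average
    over j < m of the elements [iter j h b], where m is a unit because the
    residue characteristic is p, is fixed by h and still congruent to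
    a ^ (p ^ s).  It remains to undo the p ^ s-th power by raising to a further
    power of p, which is possible because the class of a is fixed by some power
    of the Frobenius endomorphism ([exists_Frobenius_fixed]).

    This last fact is where the finiteness of the residue field of F is used.
    A polynomial over F that kills a, normalized so that its largest
    coefficients have value 1, shows that modulo the maximal ideal all powers
    of a are combinations of finitely many of them with integral coefficients in
    F ([powers_congm_span]).  These coefficients matter only through their
    residue classes, so two of the elements a ^ (p ^ i) are congruent, and the
    injectivity of Frobenius gives the claim. *)

(** * Congruence modulo the maximal ideal *)

Definition congm (R : realType) (K : fieldType) (v : K -> R) (a b : K) : Prop :=
  v (a - b) < 1.

Section Congruence.

Variables (R : realType) (K : fieldType) (v : K -> R).
Hypothesis hv : is_nonarchimedean v.

Local Notation "a ≡ b" := (congm v a b) (at level 70).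

Lemma val_ge0 a : 0 <= v a.
Proof. by have [[]] := hv. Qed.

Lemma val_eq0 a : v a = 0 <-> a = 0.
Proof. by have [[]] := hv. Qed.

Lemma valM a b : v (a * b) = v a * v b.
Proof. by have [[]] := hv. Qed.

Lemma val0 : v 0 = 0.
Proof. exact/val_eq0. Qed.

Lemma val1 : v 1 = 1.
Proof.
have v1_neq0 : v 1 != 0 by apply/eqP => /val_eq0/eqP; rewrite oner_eq0.
by apply: (mulfI v1_neq0); rewrite -valM !mulr1.
Qed.

Lemma valN a : v (- a) = v a.
Proof.
have : v (-1) ^+ 2 == 1 by rewrite expr2 -valM mulrNN mulr1 val1.
rewrite sqrf_eq1 => /orP[/eqP vN1|/eqP vN1].
  by rewrite -mulN1r valM vN1 mul1r.
by have := val_ge0 (-1); rewrite vN1 oppr_ge0 ler10.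
Qed.

Lemma valB_le c a b : v a <= c -> v b <= c -> v (a - b) <= c.
Proof.
by move=> va vb; have [_ /(_ a b)/le_trans->//] := hv; rewrite ge_max va vb.
Qed.

Lemma valD_le c a b : v a <= c -> v b <= c -> v (a + b) <= c.
Proof. by move=> va vb; rewrite -[b]opprK; apply: valB_le; rewrite ?valN. Qed.

Lemma valD_lt c a b : v a < c -> v b < c -> v (a + b) < c.
Proof.
move=> va vb; rewrite -[b]opprK; have [_ /(_ a (- b))/le_lt_trans->//] := hv.
by rewrite gt_max va valN vb.
Qed.

Lemma valX a n : v (a ^+ n) = v a ^+ n.
Proof. by elim: n => [|n IHn]; rewrite ?val1// !exprS valM IHn. Qed.

Lemma valV a : v a^-1 = (v a)^-1.
Proof.
have [->|a_neq0] := eqVneq a 0; first by rewrite invr0 val0 invr0.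
have va_neq0 : v a != 0 by apply/eqP => /val_eq0/eqP; exact/negP.
by apply: (mulfI va_neq0); rewrite -valM !divff ?val1.
Qed.

Lemma val_sum_lt1 (I : Type) (r : seq I) (P : pred I) (f : I -> K) :
  (forall i, P i -> v (f i) < 1) -> v (\sum_(i <- r | P i) f i) < 1.
Proof.
by move=> vf; elim/big_ind: _ => //; [rewrite val0|move=> ? ?; exact: valD_lt].
Qed.

Lemma val_sum_le1 (I : Type) (r : seq I) (P : pred I) (f : I -> K) :
  (forall i, P i -> v (f i) <= 1) -> v (\sum_(i <- r | P i) f i) <= 1.
Proof.
by move=> vf; elim/big_ind: _ => //; [rewrite val0|move=> ? ?; exact: valD_le].
Qed.

Lemma valM_le1 a b : v a <= 1 -> v b <= 1 -> v (a * b) <= 1.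
Proof. by move=> va vb; rewrite valM mulr_ile1 ?val_ge0. Qed.

Lemma valM_lt1 a b : v a <= 1 -> v b < 1 -> v (a * b) < 1.
Proof.
move=> va vb; rewrite valM; apply: le_lt_trans vb.
by rewrite ler_piMl ?val_ge0.
Qed.

Lemma valX_le1 a n : v a <= 1 -> v (a ^+ n) <= 1.
Proof. by move=> va; rewrite valX exprn_ile1 ?val_ge0. Qed.

Lemma val_nat_le1 n : v n%:R <= 1.
Proof.
elim: n => [|n IHn]; first by rewrite val0.
by rewrite -natr1 valD_le ?val1.
Qed.

Lemma congm_refl a : a ≡ a.
Proof. by rewrite /congm subrr val0. Qed.

Lemma congm_sym a b : a ≡ b -> b ≡ a.
Proof. by rewrite /congm -opprB valN. Qed.

Lemma congm_trans b a c : a ≡ b -> b ≡ c -> a ≡ c.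
Proof. by move=> ab bc; rewrite /congm -(subrKA b) valD_lt. Qed.

Lemma congm0 a : a ≡ 0 <-> v a < 1.
Proof. by rewrite /congm subr0. Qed.

Lemma congm_integral a b : a ≡ b -> v a <= 1 -> v b <= 1.
Proof.
by move=> ab va; rewrite -(subKr a b) valB_le// ltW.
Qed.

Lemma congmD a b c d : a ≡ b -> c ≡ d -> a + c ≡ b + d.
Proof. by move=> ab cd; rewrite /congm opprD addrACA valD_lt. Qed.

Lemma congmM a b c d :
  v a <= 1 -> v d <= 1 -> a ≡ b -> c ≡ d -> a * c ≡ b * d.
Proof.
move=> va vd ab cd; rewrite /congm.
have -> : a * c - b * d = a * (c - d) + d * (a - b).
  by rewrite !mulrBr addrA -[d * a]mulrC subrK [d * b]mulrC.
by apply: valD_lt; exact: valM_lt1.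
Qed.

Lemma congmX a b n : v a <= 1 -> a ≡ b -> a ^+ n ≡ b ^+ n.
Proof.
move=> va ab; have vb := congm_integral ab va.
elim: n => [|n IHn]; first exact: congm_refl.
by rewrite !exprS; apply: congmM => //; exact: valX_le1.
Qed.

Lemma congm_sum (I : Type) (r : seq I) (P : pred I) (f f' : I -> K) :
  (forall i, P i -> f i ≡ f' i) ->
  \sum_(i <- r | P i) f i ≡ \sum_(i <- r | P i) f' i.
Proof.
move=> ff'; elim/big_ind2: _ => //; first exact: congm_refl.
by move=> *; exact: congmD.
Qed.

Lemma congm_prod_const n (f : 'I_n -> K) a : v a <= 1 ->
  (forall i, f i ≡ a) -> \prod_(i < n) f i ≡ a ^+ n.
Proof.
move=> va; elim: n f => [|n IHn] f fa.
  by rewrite big_ord0; exact: congm_refl.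
have vf i : v (f i) <= 1 by apply: congm_integral va; exact: congm_sym.
rewrite big_ord_recl exprS; apply: congmM => //; first exact: valX_le1.
exact: IHn.
Qed.

(** * Residue characteristic p *)

Variable p : nat.
Hypotheses (p_pr : prime p) (vp : v p%:R < 1).

Lemma val_nat_dvd n : (p %| n)%N -> v n%:R < 1.
Proof.
by case/dvdnP => k ->; rewrite natrM valM_lt1// val_nat_le1.
Qed.

(** By Bezout, if both p and n had value less than 1, so would 1. *)
Lemma val_nat_coprime n : coprime p n -> v n%:R = 1.
Proof.
move=> pn; apply/eqP; rewrite eq_le val_nat_le1 leNgt /=; apply/negP => vn.
have [a b e _] := egcdnP n (prime_gt0 p_pr).
have : v 1 < 1; last by rewrite val1 ltxx.
rewrite (eqP pn) in e.
have -> : 1 = a%:R * p%:R - b%:R * n%:R :> K.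
  by rewrite -!natrM e natrD addrC addKr.
by apply: valD_lt; rewrite ?valN valM_lt1 ?val_nat_le1.
Qed.

(** The inner binomial coefficients of the p-th power are divisible by p. *)
Lemma congm_FrobeniusD a b : v a <= 1 -> v b <= 1 ->
  (a + b) ^+ p ≡ a ^+ p + b ^+ p.
Proof.
move=> va vb; rewrite exprDn; have p_gt0 := prime_gt0 p_pr.
rewrite -(prednK p_gt0) big_ord_recl big_ord_recr /= prednK//.
have -> : bump 0 p.-1 = p by rewrite /bump add1n prednK.
rewrite subn0 bin0 binn subnn !expr0 mulr1 mul1r !mulr1n.
rewrite addrCA -[X in _ ≡ X]add0r.
apply: congmD; last exact: congm_refl.
apply/congm0.
apply: val_sum_lt1 => i _.
rewrite -mulr_natl mulrC; apply: valM_lt1.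
  by apply: valM_le1; exact: valX_le1.
apply: val_nat_dvd; apply: prime_dvd_bin => //=.
by rewrite /bump /= add1n -ltn_predRL.
Qed.

(** The residue field is reduced, so its Frobenius endomorphism is injective. *)
Lemma congm_Frobenius_inj a b n : v a <= 1 -> v b <= 1 ->
  a ^+ (p ^ n) ≡ b ^+ (p ^ n) -> a ≡ b.
Proof.
elim: n a b => [|n IHn] a b va vb; first by rewrite !expr1.
rewrite expnSr !exprM => abp.
apply: IHn => //; move: abp.
move: (valX_le1 (p ^ n) va) (valX_le1 (p ^ n) vb).
move: (a ^+ _) (b ^+ _) => {va vb} {}a {}b va vb ab.
have vab : v (a - b) <= 1 by exact: valB_le.
have := congm_FrobeniusD vab vb; rewrite subrK => abp.
have : v ((a - b) ^+ p) < 1.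
  apply/congm0.
  have := congmD (congm_trans (congm_sym abp) ab) (congm_refl (- (b ^+ p))).
  by rewrite addrK subrr.
by rewrite valX expr_lt1 ?val_ge0 ?prime_gt0.
Qed.

Lemma congm_iter_Frobenius a n k : v a <= 1 ->
  a ^+ (p ^ n) ≡ a -> a ^+ (p ^ (n * k)) ≡ a.
Proof.
move=> va an; elim: k => [|k IHk].
  by rewrite muln0 expr1; exact: congm_refl.
rewrite mulnS expnD exprM; apply: congm_trans IHk.
by apply: congmX => //; exact: valX_le1.
Qed.

(** * Fixed points of isometric automorphisms in stable residue classes *)

(** Makes products and sums over a cycle of an automorphism invariant under it. *)
Lemma big_shift_cycle (idx : K) (op : Monoid.com_law idx) n (f : nat -> K) :
  f n = f 0%N -> \big[op/idx]_(i < n) f i.+1 = \big[op/idx]_(i < n) f i.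
Proof.
case: n => [|n fn]; first by rewrite !big_ord0.
by rewrite big_ord_recr big_ord_recl /= fn Monoid.mulmC.
Qed.

(** Lets the iterates of g be treated as automorphisms in their own right. *)
Lemma iter_rmorphism (h : {rmorphism K -> K}) n :
  exists h' : {rmorphism K -> K}, h' =1 iter n h.
Proof.
elim: n => [|n [h' h'E]]; first by exists idfun.
by exists (h \o h') => x /=; rewrite h'E.
Qed.

Lemma iter_isometry (h : K -> K) n : is_isometry v h -> is_isometry v (iter n h).
Proof. by move=> hi x y; elim: n => //= n <-. Qed.

Lemma val_isometry (h : {rmorphism K -> K}) x : is_isometry v h -> v (h x) = v x.
Proof. by move=> /(_ x 0); rewrite rmorph0 !subr0. Qed.

Lemma congm_isometry (h : K -> K) a b : is_isometry v h -> h a ≡ h b <-> a ≡ b.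
Proof. by move=> hi; rewrite /congm hi. Qed.

Lemma congm_iter (h : K -> K) a n : is_isometry v h -> h a ≡ a -> iter n h a ≡ a.
Proof.
move=> hi ha; elim: n => [|n IHn] /=; first exact: congm_refl.
by apply: congm_trans ha; apply/congm_isometry.
Qed.

(** A norm over the p-part of the cyclic group generated by h, followed by a
    normalized trace over its prime-to-p part.  A trace alone would not do,
    since dividing by a multiple of p destroys integrality, and a norm alone
    would only give the class of [a ^+ N], from which that of a cannot in general
    be recovered by raising to a power. *)
Lemma exists_fixed_point_congm (h : {rmorphism K -> K}) a N n :
    is_isometry v h -> v a <= 1 -> h a ≡ a ->
    (0 < N)%N -> iter N h a = a -> (0 < n)%N -> a ^+ (p ^ n) ≡ a ->
  exists2 x, h x = x & x ≡ a.
Proof.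
move=> hi va ha N_gt0 haN n_gt0 an.
have [m pm Nms] := pfactor_coprime p_pr N_gt0; set s := logn p N in Nms.
have vm := val_nat_coprime pm.
have m_neq0 : m%:R != 0 :> K.
  by apply/eqP => m0; move: vm; rewrite m0 val0 => /eqP; rewrite eq_sym oner_eq0.
pose b := \prod_(i < p ^ s) iter (m * i) h a.
have hb : iter m h b = b.
  have [h' h'E] := iter_rmorphism h m.
  rewrite -h'E rmorph_prod.
  rewrite -[RHS](@big_shift_cycle _ _ _ (fun i => iter (m * i) h a)).
    by apply: eq_bigr => i _; rewrite h'E -iterD mulnS.
  by rewrite -Nms haN muln0.
have ba : b ≡ a ^+ (p ^ s).
  by apply: congm_prod_const => // i; exact: congm_iter.
have vas := valX_le1 (p ^ s) va.
have vb : v b <= 1 := congm_integral (congm_sym ba) vas.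
have hbb : h b ≡ b.
  apply: congm_trans (congm_sym ba).
  apply: (@congm_trans (h (a ^+ (p ^ s)))); first exact/congm_isometry.
  by rewrite rmorphXn; apply: congmX => //; rewrite val_isometry.
pose y := \sum_(j < m) iter j h b.
have hy : h y = y.
  rewrite rmorph_sum.
  by rewrite -[RHS](@big_shift_cycle _ _ _ (fun i => iter i h b)).
have yb : y ≡ m%:R * b.
  rewrite mulr_natl -[X in b *+ X]card_ord -sumr_const.
  by apply: congm_sum => j _; exact: congm_iter.
have yma : y / m%:R ≡ a ^+ (p ^ s).
  apply: congm_trans ba; rewrite -[b](mulKf m_neq0) mulrC.
  apply: congmM; rewrite ?valV ?vm ?invr1 ?valM_le1 ?val_nat_le1//.
  exact: congm_refl.
(* As a ^ (p ^ n) ≡ a, also a ^ (p ^ (n * s)) ≡ a; the exponent p ^ s is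
   already present in the average. *)
exists ((y / m%:R) ^+ (p ^ (n * s - s))).
  by rewrite rmorphXn rmorphM fmorphV rmorph_nat hy.
apply: (@congm_trans ((a ^+ (p ^ s)) ^+ (p ^ (n * s - s)))).
  by apply: congmX => //; apply: congm_integral vas; exact: congm_sym.
rewrite -exprM -expnD subnKC; last by rewrite leq_pmull.
exact: congm_iter_Frobenius.
Qed.

End Congruence.

(** * Elements algebraic over a valued subfield *)

Section Extension.

Variables (R : realType) (F : fieldType) (L : fieldExtType F).
Variables (vF : F -> R) (vL : L -> R).
Hypotheses (hF : is_nonarchimedean vF) (hL : is_nonarchimedean vL).
Hypothesis hFL : extends_valuation vF vL.

Local Notation "a ≡ b" := (congm vL a b) (at level 70).

Lemma algebraic_over_base (a : L) :
  exists2 Q : {poly F}, Q != 0 & root (map_poly (in_alg L) Q) a.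
Proof.
have /polyOver1P[Q QE] := minPolyOver 1%AS a.
exists Q; last by rewrite -QE root_minPoly.
apply: contraTneq (monic_minPoly 1%AS a) => Q0.
by rewrite QE Q0 map_poly0 monicE lead_coef0 eq_sym oner_eq0.
Qed.

(** The iterates of a are roots of a polynomial with coefficients in F, so two of
    them coincide; injectivity of g brings the coincidence back to a itself. *)
Lemma iter_periodic (g : {rmorphism L -> L}) (a : L) :
  (forall c : F, g c%:A = c%:A) -> exists2 N, (0 < N)%N & iter N g a = a.
Proof.
move=> gF; have [Q Q_neq0 Qa] := algebraic_over_base a.
pose P := map_poly (in_alg L) Q.
have P_neq0 : P != 0 by rewrite map_poly_eq0.
have groot i : root P (iter i g a).
  elim: i => //= i /rootP Pi; apply/rootP.
  have PE : P = map_poly g P by apply/polyP => j; rewrite !coef_map /= gF.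
  by rewrite PE horner_map Pi rmorph0.
have /trajectP[i i_lt giE] : looping g a (size P).
  rewrite -[looping _ _ _]negbK -looping_uniq; apply/negP => u.
  have := max_poly_roots P_neq0 _ u.
  rewrite size_traject ltnNge leqnSn => /implyP; rewrite implybF => /negP; apply.
  by apply/allP => x /trajectP[j _ ->].
exists (size P - i)%N; first by rewrite subn_gt0.
have g_inj : injective (iter i g).
  by elim: (i) => [|k IHk] x y //= /fmorph_inj/IHk.
by apply: g_inj; rewrite -iterD subnKC // ltnW.
Qed.

(** Divide a polynomial killing a by its last coefficient of largest value: the
    higher terms disappear modulo the maximal ideal. *)
Lemma exists_residually_monic (a : L) : vL a <= 1 ->
  exists (d : nat) (q : 'I_d -> F), (forall i, vF (q i) <= 1) /\
    a ^+ d ≡ \sum_(i < d) (q i)%:A * a ^+ i.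
Proof.
move=> va; have [Q Q_neq0 Qa] := algebraic_over_base a.
have sQ : (0 < size Q)%N by rewrite lt0n size_poly_eq0.
have [/= i0 _ i0_max] := @Order.TotalTheory.arg_maxP _ _ _ (Ordinal sQ) xpredT
  (fun i : 'I_(size Q) => vF Q`_i) isT.
pose M := vF Q`_i0.
have le_M i : vF Q`_i <= M.
  have [i_lt|i_ge] := ltnP i (size Q); first exact: (i0_max (Ordinal i_lt)).
  by rewrite nth_default// (val0 hF) (val_ge0 hF).
have M_gt0 : 0 < M.
  rewrite lt_neqAle (val_ge0 hF) andbT eq_sym; apply/eqP => M0.
  move: Q_neq0; rewrite -lead_coef_eq0 => /eqP; apply; apply/(val_eq0 hF).
  by apply/eqP; rewrite eq_le (val_ge0 hF) andbT -M0 le_M.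
have exd : exists i, vF Q`_i == M by exists i0.
have ubd i : vF Q`_i == M -> (i <= size Q)%N.
  move=> /eqP viM; rewrite leqNgt; apply/negP => i_gt.
  by move: M_gt0; rewrite -viM nth_default ?(val0 hF) ?ltxx// ltnW.
have [d /eqP vd d_max] := ex_maxnP exd ubd.
have Qd_neq0 : Q`_d != 0.
  by apply/eqP => Qd0; move: M_gt0; rewrite -vd Qd0 (val0 hF) ltxx.
have d_lt : (d < size Q)%N.
  by rewrite ltnNge; apply: contra Qd_neq0 => ?; rewrite nth_default.
have vdiv i : vF (Q`_i / Q`_d) = vF Q`_i / M by rewrite (valM hF) (valV hF) vd.
exists d, (fun i => - (Q`_i / Q`_d)); split=> [i|].
  by rewrite (valN hF) vdiv ler_pdivrMr// mul1r.
move/rootP: Qa; rewrite horner_coef size_map_poly => Qa.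
pose f i : L := (Q`_i / Q`_d)%:A * a ^+ i.
have sumf : \sum_(i < size Q) f i = 0.
  transitivity (\sum_(i < size Q)
      (Q`_d)^-1%:A * ((map_poly (in_alg L) Q)`_i * a ^+ i)).
    apply: eq_bigr => i _.
    by rewrite coef_map/= /f mulrA -!in_algE -rmorphM [_^-1 * _]mulrC.
  by rewrite -mulr_sumr Qa mulr0.
have fd : f d = a ^+ d by rewrite /f divff// scale1r mul1r.
have := sumf.
rewrite -(big_mkord xpredT f) (big_cat_nat (n := d))//=; last exact: ltnW.
rewrite [X in _ + X]big_ltn// fd !big_mkord => /eqP.
rewrite addrA addr_eq0 addrC => /eqP sum0.
rewrite /congm.
have -> : a ^+ d - \sum_(i < d) (- (Q`_i / Q`_d))%:A * a ^+ i =
    - \sum_(d.+1 <= i < size Q) f i.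
  rewrite -sum0; congr (_ + _); rewrite -sumrN; apply: eq_bigr => i _.
  by rewrite /f scaleNr mulNr opprK.
rewrite (valN hL) big_seq_cond; apply: (val_sum_lt1 hL) => i.
rewrite mem_index_iota andbT => /andP[i_gt _].
rewrite /f mulrC; apply: (valM_lt1 hL); first exact: valX_le1.
rewrite hFL vdiv ltr_pdivrMr// mul1r lt_neqAle le_M andbT.
by apply: contraTN i_gt => /eqP viM; rewrite -leqNgt; apply: d_max; apply/eqP.
Qed.

(** For k >= d, write a ^ k as a ^ (k - d) * a ^ d and substitute for a ^ d: only
    powers with exponent less than k remain. *)
Lemma powers_congm_span (a : L) : vL a <= 1 ->
  exists d : nat, forall k, exists2 c : 'I_d -> F,
    (forall i, vF (c i) <= 1) & a ^+ k ≡ \sum_(i < d) (c i)%:A * a ^+ i.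
Proof.
move=> va; have [d [q [vq aq]]] := exists_residually_monic va.
exists d; elim/ltn_ind => k IHk.
have [k_lt|d_le] := ltnP k d.
  exists (fun i => (i == Ordinal k_lt)%:R) => [i|].
    by rewrite (val_nat_le1 hF).
  rewrite (bigD1 (Ordinal k_lt)) //= eqxx scale1r mul1r big1 ?addr0.
    exact: (congm_refl hL).
  by move=> i /negPf->; rewrite scale0r mul0r.
have lt_k (i : 'I_d) : (k - d + i < k)%N.
  by rewrite -[X in (_ < X)%N](subnK d_le) ltn_add2l.
have {IHk} /choice[c IHk] (i : 'I_d) : exists c : 'I_d -> F,
    (forall j, vF (c j) <= 1) /\
    a ^+ (k - d + i) ≡ \sum_(j < d) (c j)%:A * a ^+ j.
  by have [c ? ?] := IHk _ (lt_k i); exists c.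
exists (fun j => \sum_(i < d) q i * c i j) => [j|].
  apply: (val_sum_le1 hF) => i _; apply: (valM_le1 hF) => //.
  by have [] := IHk i.
apply: (@congm_trans _ _ _ hL (\sum_(i < d) (q i)%:A * a ^+ (k - d + i))).
  under eq_bigr do rewrite exprD mulrCA.
  rewrite -mulr_sumr -{1}(subnK d_le) exprD.
  apply: (congmM hL) => //; try exact: valX_le1; last exact: (congm_refl hL).
  apply: (val_sum_le1 hL) => i _; apply: (valM_le1 hL); last exact: valX_le1.
  by rewrite hFL.
apply: (@congm_trans _ _ _ hL
  (\sum_(i < d) (q i)%:A * \sum_(j < d) (c i j)%:A * a ^+ j)).
  apply: (congm_sum hL) => i _; have [vc ac] := IHk i.
  apply: (congmM hL) => //; rewrite ?hFL//; last exact: (congm_refl hL).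
  apply: (val_sum_le1 hL) => j _; apply: (valM_le1 hL); last exact: valX_le1.
  by rewrite hFL.
under eq_bigr do rewrite mulr_sumr.
rewrite exchange_big /=.
under [X in _ ≡ X]eq_bigr do rewrite scaler_suml mulr_suml.
under eq_bigr do under eq_bigr do rewrite mulrA -!in_algE -rmorphM.
exact: (congm_refl hL).
Qed.

Hypothesis hfin : finite_set (residue_field vF).

Lemma residue_class_mem (a : F) : residue_class vF a a.
Proof. by exists 0; rewrite ?addr0// /max_ideal /= (val0 hF). Qed.

(** Pigeonhole on the residue classes of the coefficients in
    [powers_congm_span]. *)
Lemma exists_congm_powers (f : nat -> nat) (a : L) : vL a <= 1 ->
  exists i j, (i < j)%N /\ a ^+ f i ≡ a ^+ f j.
Proof.
move=> va; have [d /(_ (f _)) span] := powers_congm_span va.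
have {span} /choice[c cP] k : exists c : 'I_d -> F,
    (forall i, vF (c i) <= 1) /\ a ^+ f k ≡ \sum_(i < d) (c i)%:A * a ^+ i.
  by have [c ? ?] := span k; exists c.
have /finite_seqP[s sE] := hfin.
have mem_s k i : residue_class vF (c k i) \in s.
  have : [set` s] (residue_class vF (c k i)); last by [].
  by rewrite -sE; exists (c k i) => //; rewrite /integers /=; have [] := cP k.
(* Only the classes listed in s occur, so the extra index size s, which makes
   inord available, is never reached. *)
pose code k : {ffun 'I_d -> 'I_(size s).+1} :=
  [ffun i => inord (index (residue_class vF (c k i)) s)].
suff [i [j [i_lt codeE]]] : exists i j, (i < j)%N /\ code i = code j.
  exists i, j; split => //; have [_ ai] := cP i; have [vj aj] := cP j.
  apply: (congm_trans hL ai); apply: (congm_trans hL _ (congm_sym hL aj)).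
  apply: (congm_sum hL) => l _; apply: (congmM hL).
  - by rewrite hFL; have [] := cP i.
  - exact: valX_le1.
  - have /ffunP/(_ l)/(congr1 val) := codeE.
    rewrite !ffunE /= !inordK ?ltnS ?index_size// => eq_index.
    have eq_class : residue_class vF (c i l) = residue_class vF (c j l).
      by rewrite -(nth_index set0 (mem_s i l)) eq_index nth_index.
    have := residue_class_mem (c i l); rewrite eq_class => -[m vm <-].
    rewrite /congm -scalerBl hFL addrAC subrr add0r.
    exact: vm.
  - exact: (congm_refl hL).
pose n := #|{ffun 'I_d -> 'I_(size s).+1}|.
have : ~~ injectiveb (fun i : 'I_n.+1 => code i).
  by apply/negP => /injectiveP/leq_card; rewrite card_ord ltnn.
case/injectivePn => i [j i_neq codeE].
have [i_lt|j_lt|/val_inj ij] := ltngtP i j.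
- by exists i, j.
- by exists j, i.
- by rewrite ij eqxx in i_neq.
Qed.

Variable p : nat.
Hypotheses (p_pr : prime p) (vp : vL p%:R < 1).

Lemma exists_Frobenius_fixed (a : L) : vL a <= 1 ->
  exists2 n, (0 < n)%N & a ^+ (p ^ n) ≡ a.
Proof.
move=> va; have [i [j [i_lt aij]]] := exists_congm_powers (expn p) va.
exists (j - i)%N; first by rewrite subn_gt0.
apply: (congm_Frobenius_inj hL p_pr vp (n := i)) => //; first exact: valX_le1.
by rewrite -exprM -expnD subnK ?(ltnW i_lt)//; exact: congm_sym.
Qed.

End Extension.

(** * Invariant systems of representatives *)

Section InvariantRepresentatives.

Variables (R : realType) (K : fieldType) (v : K -> R).
Hypothesis hv : is_nonarchimedean v.
Variable g : {rmorphism K -> K}.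
Hypothesis g_iso : is_isometry v g.
Hypothesis g_periodic : forall a, exists2 N, (0 < N)%N & iter N g a = a.
Hypothesis exists_fixed : forall a k, v a <= 1 ->
  congm v (iter k g a) a -> exists2 x, iter k g x = x & congm v x a.

Local Notation "a ≡ b" := (congm v a b) (at level 70).

(** The condition that an element of a g-stable system of representatives, with
    0 as the representative of the class 0, has to satisfy. *)
Definition rigid (x : K) : Prop :=
  (v x < 1 -> x = 0) /\ forall j, iter j g x ≡ x -> iter j g x = x.

Definition same_orbit (a b : K) : Prop := exists j, iter j g a ≡ b.

Lemma iter0 j : iter j g 0 = 0.
Proof. by elim: j => //= j ->; rewrite rmorph0. Qed.

Lemma val_iter j x : v (iter j g x) = v x.
Proof. by elim: j => //= j <-; rewrite (val_isometry _ g_iso). Qed.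

Lemma congm_iter_iff j a b : iter j g a ≡ iter j g b <-> a ≡ b.
Proof. by apply: congm_isometry; exact: iter_isometry. Qed.

Lemma iter_mul_fixed k q x : iter k g x = x -> iter (q * k) g x = x.
Proof. by move=> kx; elim: q => //= q IHq; rewrite mulSn iterD IHq. Qed.

(** The period of a lets one return from [iter j g a] to a by applying g only. *)
Lemma same_orbit_sym a b : same_orbit a b -> same_orbit b a.
Proof.
move=> [j ab]; have [[//|N] _ aN] := g_periodic a.
exists (j * N)%N; apply: (congm_sym hv).
by rewrite -{1}(iter_mul_fixed j aN) mulnS addnC iterD; apply/congm_iter_iff.
Qed.

Lemma same_orbit_trans a b c : same_orbit a b -> same_orbit b c -> same_orbit a c.
Proof.
move=> [i ab] [j bc]; exists (j + i)%N; rewrite iterD.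
by apply: (congm_trans hv _ bc); apply/congm_iter_iff.
Qed.

(** Take k to be the length of the orbit of the class of a; a fixed point of the
    k-th iterate in this class has k as its exact period. *)
Lemma exists_rigid a : v a <= 1 -> exists2 x, rigid x & x ≡ a.
Proof.
move=> va; have [va_lt1|va_ge1] := ltP (v a) 1.
  exists 0; last by apply: (congm_sym hv); apply/congm0.
  by split=> // j _; exact: iter0.
have ex_k : exists k, `[< (0 < k)%N /\ iter k g a ≡ a >].
  have [N N_gt0 aN] := g_periodic a.
  by exists N; apply/asboolP; rewrite aN; split=> //; exact: (congm_refl hv).
have [k /asboolP[k_gt0 ka] k_min] := ex_minnP ex_k.
have [x kx xa] := exists_fixed va ka.
exists x => //; split=> [vx|j jx].
  have /congm0 := congm_trans hv (congm_sym hv xa) (iffRL (congm0 v x) vx).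
  by rewrite ltNge va_ge1.
have mod_x : iter (j %% k) g x ≡ x.
  by move: jx; rewrite {1}(divn_eq j k) addnC iterD iter_mul_fixed.
have mod_a : iter (j %% k) g a ≡ a.
  apply: (congm_trans hv _ xa); apply: (congm_trans hv _ mod_x).
  by apply/congm_iter_iff; exact: congm_sym.
suff /eqP j0 : (j %% k == 0)%N.
  by rewrite (divn_eq j k) j0 addn0 iter_mul_fixed.
rewrite -leqn0 leqNgt; apply/negP => mod_gt0.
have /k_min : `[< (0 < j %% k)%N /\ iter (j %% k) g a ≡ a >] by exact/asboolP.
by rewrite leqNgt ltn_pmod.
Qed.

(** The default 0 of [xget] is never reached for integral a.  The element chosen
    depends only on the set of candidates, hence only on the orbit of the class
    of a, as [eq_orbit_rep] records. *)
Definition orbit_rep (a : K) : K := xget 0 [set x | rigid x /\ same_orbit x a].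

Lemma orbit_repP a : v a <= 1 -> rigid (orbit_rep a) /\ same_orbit (orbit_rep a) a.
Proof.
move=> va; rewrite /orbit_rep; case: xgetP => [x _ []//|none].
have [x x_rigid xa] := exists_rigid va.
by case: (none x); split=> //; exists 0%N.
Qed.

Lemma eq_orbit_rep a b : same_orbit a b -> orbit_rep a = orbit_rep b.
Proof.
move=> ab; congr (xget 0 _); apply/seteqP; split=> x [x_rigid xo]; split=> //.
  exact: same_orbit_trans ab.
by apply: same_orbit_trans xo _; exact: same_orbit_sym.
Qed.

Definition orbit_reps : set K :=
  [set x | exists i a, v a <= 1 /\ x = iter i g (orbit_rep a)].

Lemma orbit_repsP x : orbit_reps x -> v x = 1 \/ x = 0.
Proof.
move=> [i [a [va ->]]]; have [[small_eq0 _] [j ra]] := orbit_repP va.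
rewrite val_iter; have [/small_eq0->|v_ge1] := ltP (v (orbit_rep a)) 1.
  by right; exact: iter0.
left; apply/eqP; rewrite eq_le v_ge1 andbT -(val_iter j).
by apply: congm_integral (congm_sym hv ra) va.
Qed.

(** Congruent elements come from the same orbit, hence from the same chosen x;
    then [iter i g x ≡ iter j g x] reduces, g being isometric, to the rigidity of
    x. *)
Lemma orbit_reps_inj x y : orbit_reps x -> orbit_reps y -> x ≡ y -> x = y.
Proof.
move=> [i [a [va ->]]] [j [b [vb ->]]].
wlog ij : i j a b va vb / (i <= j)%N.
  move=> wlog_ij xy; have [/wlog_ij|/ltnW/wlog_ij ji] := leqP i j; first exact.
  by apply/esym/ji => //; exact: congm_sym.
have [_ ra] := orbit_repP va; have [[_ b_rigid] rb] := orbit_repP vb.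
move=> xy; have ab : orbit_rep a = orbit_rep b.
  apply: eq_orbit_rep; apply: same_orbit_trans rb.
  apply: (@same_orbit_trans _ (iter j g (orbit_rep b))); last first.
    by apply: same_orbit_sym; exists j; exact: congm_refl.
  apply: same_orbit_trans (same_orbit_sym ra) _.
  by exists i.
move: xy; rewrite ab -(subnKC ij) iterD => /congm_iter_iff xy.
by rewrite (b_rigid (j - i)%N)//; exact: congm_sym.
Qed.

Lemma residue_classE a x : residue_class v a x <-> x ≡ a.
Proof.
split=> [[m vm <-]|xa]; first by rewrite /congm addrAC subrr add0r.
by exists (x - a) => //; rewrite addrC subrK.
Qed.

Lemma orbit_reps_representatives : residue_representatives v orbit_reps.
Proof.
split.
- by move=> x /orbit_repsP; rewrite /integers /= => -[|] ->; rewrite ?(val0 hv).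
- have v0 : v 0 <= 1 by rewrite (val0 hv).
  have [[small_eq0 _] [j r0]] := orbit_repP v0.
  exists 0%N, 0; split=> //=; rewrite small_eq0// -(val_iter j).
  exact/congm0.
- move=> C [a va <-]; have [_ [i ra]] := orbit_repP va.
  exists (iter i g (orbit_rep a)); split.
    by split; [exists i, a | exact/residue_classE].
  move=> y [Sy /residue_classE ya]; apply: orbit_reps_inj => //.
    by exists i, a.
  by apply: (congm_trans hv ra); exact: congm_sym.
Qed.

Lemma orbit_reps_stable x : orbit_reps x -> orbit_reps (g x).
Proof. by move=> [i [a [va ->]]]; exists i.+1, a. Qed.

End InvariantRepresentatives.

(** * Conclusion *)

Lemma val_residue_char_lt1 (R : realType) (F : fieldType) (vF : F -> R)
    (iota : {rmorphism rat -> F}) (nu : F -> \bar R) (p : nat) :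
  is_valuation_log vF nu -> prime p ->
  (forall q : rat, nu (iota q) = padic_log R p q) -> vF p%:R < 1.
Proof.
move=> [_ [r r_gt1 vE]] p_pr nuE.
have nup : nu p%:R = 1%:E.
  rewrite -(rmorph_nat iota) nuE /padic_log.
  rewrite pnatr_eq0 eqn0Ngt prime_gt0//=.
  rewrite -[p%:R]/(p%:Z%:~R) numq_int denq_int /= logn1 subr0.
  by rewrite (pfactorK 1) // lognn.
have r_gt0 : 0 < r by exact: lt_trans r_gt1.
by rewrite vE nup /= powRN powRr1 ?ltW// invf_lt1.
Qed.

Theorem lemma5p4p12 (R : realType) (F : fieldType) (L : fieldExtType F)
    (vF : F -> R) (vL : L -> R)
    (hF : is_nonarchimedean vF) (hL : is_nonarchimedean vL)
    (hFL : extends_valuation vF vL)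
    (iota : {rmorphism rat -> F}) (nu : F -> \bar R) (p : nat)
    (hnu : is_valuation_log vF nu) (hp : prime p)
    (hnup : forall q : rat, nu (iota q) = padic_log R p q)
    (hfin : finite_set (residue_field vF))
    (hiso : forall g : {rmorphism L -> L}, in_Gal g -> is_isometry vL g) :
  forall g : {rmorphism L -> L}, in_Gal g ->
    exists S : set L,
      [/\ S `<=` integer_units vL `|` [set 0],
          residue_representatives vL S
        & forall x, S x -> S (g x)].
Proof.
move=> g gGal; have g_iso := hiso g gGal; have [_ gF] := gGal.
have vp : vL p%:R < 1.
  by rewrite -(rmorph_nat (in_alg L)) hFL (val_residue_char_lt1 hnu hp hnup).
have g_per a := iter_periodic a gF.
have g_fix a k : vL a <= 1 -> congm vL (iter k g a) a ->
    exists2 x, iter k g x = x & congm vL x a.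
  move=> va; have [h hE] := iter_rmorphism g k; rewrite -hE => ha.
  have h_iso : is_isometry vL h.
    by move=> x y; rewrite !hE; exact: iter_isometry.
  have [|N N_gt0 aN] := @iter_periodic _ _ h a.
    by move=> c; rewrite hE; elim: (k) => //= n ->.
  have [n n_gt0 an] := exists_Frobenius_fixed hF hL hFL hfin hp vp va.
  have [x hx xa] := exists_fixed_point_congm hL hp vp h_iso va ha N_gt0 aN n_gt0 an.
  by exists x => //; rewrite -hE.
exists (orbit_reps vL g); split.
- by move=> x /(orbit_repsP hL g_iso g_per g_fix).
- exact: orbit_reps_representatives.
- exact: orbit_reps_stable.
Qed.
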